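(* Let $K$ be a field of characteristic $p\ge 0$ with algebraic closure $\overline{K}$. Suppose $f_1,f_2\in K[x]\setminus K[x^p]$ and $\alpha,\beta\in\overline{K}$ satisfy $f_i(\alpha)=f_i(\beta)$ for both $i=1$ and $i=2$. For $a\in\overline{K}$ let $m_i(a)$ denote the multiplicity of $x=a$ as a root of $f_i(x)-f_i(a)$. Then $f_1$ and $f_2$ have no common composite if either of the following holds: (i) $m_1(\alpha)m_2(\beta)\ne m_1(\beta)m_2(\alpha)$; or (ii) $f_1'(\alpha)f_2'(\beta)\ne f_1'(\beta)f_2'(\alpha)$, and $[K(\alpha):K]$ is divisible by a prime greater than $\max(\deg(f_1),\deg(f_2))$.
   Context: Nonconstant polynomials $f_1,f_2\in K[x]$ have a common composite (over $K$) if there are nonconstant $u,v\in K[x]$ such that $u(f_1(x))=v(f_2(x))$. When $p=0$, $K[x^p]$ means $K$; in every characteristic, $f\in K[x]\setminus K[x^p]$ means that the derivative $f'$ is nonzero. *)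

(* Defs.v *)
From HB Require Import structures.
From mathcomp Require Import all_boot all_order all_algebra.

Set Implicit Arguments.
Unset Strict Implicit.
Unset Printing Implicit Defensive.

Import GRing.Theory.
Local Open Scope ring_scope.

(* [1 < size p] says that p is nonconstant. *)
Definition common_composite (K : fieldType) (f1 f2 : {poly K}) : Prop :=
  exists u v : {poly K},
    [/\ (1 < size u)%N, (1 < size v)%N & u \Po f1 = v \Po f2].

(* The field K is embedded in L by iota.  The type closedFieldType only says
   that L is algebraically closed, so algebraicity over K is a hypothesis. *)
Definition algebraic_closure (K : fieldType) (L : closedFieldType)
    (iota : {rmorphism K -> L}) : Prop :=
  forall z : L, algebraicOver iota z.

Definition fval_mult (L : fieldType) (f : {poly L}) (a : L) : nat :=
  mup a (f - f.[a]%:P).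

(* Membership in the subfield K(a) of L.  Since L may have infinite dimension
   over K, the {subfield L} of fieldext is not available.  As 0^-1 = 0, closure
   under division needs no side condition. *)
Inductive in_adjoin (K L : fieldType) (iota : {rmorphism K -> L}) (a : L) :
    L -> Prop :=
| in_adjoin_base c : in_adjoin iota a (iota c)
| in_adjoin_gen : in_adjoin iota a a
| in_adjoin_sub x y :
    in_adjoin iota a x -> in_adjoin iota a y -> in_adjoin iota a (x - y)
| in_adjoin_div x y :
    in_adjoin iota a x -> in_adjoin iota a y -> in_adjoin iota a (x / y).

(* [K(a) : K] = d, that is, K(a) has a K-basis of d elements. *)
Definition adjoin_has_degree (K L : fieldType) (iota : {rmorphism K -> L})
    (a : L) (d : nat) : Prop :=
  exists b : 'I_d -> L,
    [/\ forall i, in_adjoin iota a (b i),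
        forall x, in_adjoin iota a x ->
          exists c : 'I_d -> K, x = \sum_(i < d) iota (c i) * b i
      & forall c : 'I_d -> K,
          \sum_(i < d) iota (c i) * b i = 0 -> forall i, c i = 0].

(* Main.v *)
Require Import Defs.
From mathcomp Require Import all_boot all_order all_algebra all_field.
From Stdlib Require Import Classical.

Set Implicit Arguments.
Unset Strict Implicit.
Unset Printing Implicit Defensive.

Import GRing.Theory.
Local Open Scope ring_scope.

(** Suppose that [h = u \Po f1 = v \Po f2] is a common composite.

    Case (i). The multiplicity of [a] as a root of [h - h(a)] is the product of
    the multiplicity of [a] for [f1] and that of [f1(a)] for [u]
    ([fval_mult_comp]).  The second factor is the same at
    [alpha] and at [beta] because [f1] takes the same value there, so the
    ratio of the multiplicities of [h] at [alpha] and [beta] is the ratio of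
    those of [f1]; likewise it is the ratio of those of [f2].

    Case (ii). If [h] has a nonzero derivative at [alpha], the chain rule shows
    in the same way that [(f1'(alpha), f1'(beta))] and [(f2'(alpha), f2'(beta))]
    are both proportional to [(h'(alpha), h'(beta))].  In
    general [h] may be ramified at [alpha], so it is replaced by another common
    composite, over [L], with a simple zero at [alpha].  Let [q] be the large
    prime and let [C] be the finite set of those roots [c] of [h - h(alpha)]
    for which [q] divides [[K(c) : K]].

    - [C] is a union of fibres of [f1] and also of [f2].  Indeed, if
      [f(c) = f(d)] with [f] of degree less than [q], then [K(c)] has degree
      less than [q] over [K(f(c))], so the factor [q] of [[K(c) : K]] comes
      from [[K(f(c)) : K]], and this degree divides [[K(d) : K]]
      ([divides_degree_fibre]).
    - No point of [C] is a zero of [f1'] or [f2'], whose degrees are less than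
      [q] ([divides_degree_neq0]).

    So every fibre of [f1] in [C] consists of simple zeros, and the product of
    [x - c] over [c] in [C] is a polynomial in [f1]; for the same reason it is a
    polynomial in [f2] ([prod_XsubC_fibres]).  This product is squarefree and
    vanishes at [alpha], hence has a nonzero derivative there
    ([deriv_common_fibres]). *)

(** * Multiplicities of composites *)

Lemma fval_mult_eq (L : fieldType) (f : {poly L}) (a : L) m (w : {poly L}) :
  ~~ root w a -> f - f.[a]%:P = w * ('X - a%:P) ^+ m -> fval_mult f a = m.
Proof. by rewrite /fval_mult => wa ->; rewrite mupMr // mup_XsubCX eqxx. Qed.

Lemma fval_mult_factor (L : fieldType) (f : {poly L}) (a : L) :
  (1 < size f)%N ->
  exists2 w : {poly L}, ~~ root w a &
    f - f.[a]%:P = w * ('X - a%:P) ^+ fval_mult f a.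
Proof.
move=> f_nonconst.
have nz : f - f.[a]%:P != 0.
  rewrite subr_eq0; apply: contraTneq f_nonconst => ->.
  by rewrite -leqNgt size_polyC_leq1.
have [m [w]] := multiplicity_XsubC (f - f.[a]%:P) a.
by rewrite nz /= => wa Df; exists w; rewrite // {1}Df (fval_mult_eq wa Df).
Qed.

Lemma fval_mult_gt0 (L : fieldType) (f : {poly L}) (a : L) :
  (1 < size f)%N -> (0 < fval_mult f a)%N.
Proof.
move=> /(fval_mult_factor a)[w wa Df]; rewrite lt0n; apply: contraNneq wa => m0.
rewrite -[w]mulr1 -(expr0 ('X - a%:P)) -[in X in _ ^+ X]m0 -Df.
by rewrite rootE !hornerE subrr.
Qed.

(** Let [b = f(a)].  Substituting [f] for [X] in [u - u(b) = w * (X - b)^m] and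
    using [f - b = t * (X - a)^k], with [w(b)] and [t(a)] nonzero, gives
    [(X - a)^(m * k)] times a factor that does not vanish at [a]. *)
Lemma fval_mult_comp (L : fieldType) (u f : {poly L}) (a : L) :
  (1 < size u)%N -> (1 < size f)%N ->
  fval_mult (u \Po f) a = (fval_mult u f.[a] * fval_mult f a)%N.
Proof.
move=> /(fval_mult_factor f.[a])[w wb Du] /(fval_mult_factor a)[t ta Df].
apply: (@fval_mult_eq _ _ _ _ ((w \Po f) * t ^+ fval_mult u f.[a])).
  by rewrite rootM root_comp negb_or wb /root horner_exp expf_neq0.
rewrite horner_comp -[in LHS](comp_polyC _ f) -comp_polyB Du comp_polyM.
rewrite rmorphXn /= comp_polyB comp_polyX comp_polyC Df exprMn.
by rewrite -mulrA -exprM mulnC.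
Qed.

(** Multiplying either side by the multiplicities of [u] at [f1.[a]] and of [v]
    at [f2.[a]] gives the product of the multiplicities of the common composite
    at [a] and at [b]. *)
Lemma fval_mult_common (L : fieldType) (f1 f2 u v : {poly L}) (a b : L) :
  (1 < size f1)%N -> (1 < size f2)%N -> (1 < size u)%N -> (1 < size v)%N ->
  u \Po f1 = v \Po f2 -> f1.[a] = f1.[b] -> f2.[a] = f2.[b] ->
  (fval_mult f1 a * fval_mult f2 b = fval_mult f1 b * fval_mult f2 a)%N.
Proof.
move=> nc1 nc2 ncu ncv Duv e1 e2.
have Da := fval_mult_comp a ncu nc1; have Db := fval_mult_comp b ncu nc1.
rewrite Duv !fval_mult_comp // in Da Db; rewrite -e1 -e2 in Db.
have m_gt0 : (0 < fval_mult u f1.[a] * fval_mult v f2.[a])%N.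
  by rewrite muln_gt0 !fval_mult_gt0.
apply/eqP; rewrite -(eqn_pmul2l m_gt0) mulnACA [in X in _ == X]mulnACA.
by rewrite Da Db mulnC.
Qed.

(** * Squarefree unions of fibres *)

(** The product [G] of [f - c] over the values [c] of [f] on [C] has [C] as its
    set of roots, and all of them are simple because [f'] does not vanish on
    [C]; so [G] is a constant times the product of [X - a] over [C]. *)
Lemma prod_XsubC_fibres (L : closedFieldType) (f : {poly L}) (C : seq L) :
  (1 < size f)%N -> uniq C -> {in C, forall a, f^`().[a] != 0} ->
  (forall a b, a \in C -> f.[a] = f.[b] -> b \in C) ->
  exists U, U \Po f = \prod_(a <- C) ('X - a%:P).
Proof.
move=> f_nonconst uniqC f'C closedC.
pose D := undup [seq f.[a] | a <- C].
pose V := \prod_(c <- D) ('X - c%:P); pose G := V \Po f.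
have rootG x : root G x = (x \in C).
  rewrite root_comp root_prod_XsubC mem_undup.
  by apply/mapP/idP => [[a Ca /esym/(closedC a x Ca)] | Cx]; last by exists x.
have nzG : G != 0 by rewrite comp_poly_eq0 // monic_neq0 ?monic_prod_XsubC.
have sepV : separable_poly V by rewrite separable_prod_XsubC undup_uniq.
have [r DG] := closed_field_poly_normal G.
have nzlG : lead_coef G != 0 by rewrite lead_coef_eq0.
have sepG : separable_poly G.
  rewrite unlock; apply/Pdiv.ClosedField.coprimepP => x Gx.
  rewrite deriv_comp hornerM horner_comp mulf_neq0 ?f'C -?rootG //.
  move: sepV; rewrite unlock => /Pdiv.ClosedField.coprimepP; apply.
  by rewrite -root_comp.
have r_uniq : uniq r.
  by rewrite -separable_prod_XsubC -(eqp_separable (eqp_scale _ nzlG)) -DG.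
have rC : perm_eq r C.
  apply: uniq_perm => // x.
  by rewrite -rootG DG rootZ // root_prod_XsubC.
exists ((lead_coef G)^-1 *: V).
by rewrite comp_polyZ -/G {2}DG scalerA mulVf // scale1r (perm_big _ rC).
Qed.

(** The product over [C] is a common composite without multiple roots, to which
    the chain rule argument applies at [a], even if other common composites are
    ramified there. *)
Lemma deriv_common_fibres (L : closedFieldType) (f1 f2 : {poly L})
    (C : seq L) (a b : L) :
  (1 < size f1)%N -> (1 < size f2)%N -> uniq C ->
  {in C, forall c, f1^`().[c] != 0} -> {in C, forall c, f2^`().[c] != 0} ->
  (forall c d, c \in C -> f1.[c] = f1.[d] -> d \in C) ->
  (forall c d, c \in C -> f2.[c] = f2.[d] -> d \in C) ->
  a \in C -> f1.[a] = f1.[b] -> f2.[a] = f2.[b] ->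
  f1^`().[a] * f2^`().[b] = f1^`().[b] * f2^`().[a].
Proof.
move=> nc1 nc2 uC d1 d2 cl1 cl2 Ca e1 e2.
have [U DU] := prod_XsubC_fibres nc1 uC d1 cl1.
have [V DV] := prod_XsubC_fibres nc2 uC d2 cl2.
set g := \prod_(c <- C) _ in DU DV.
have g'a : g^`().[a] != 0.
  have: separable_poly g by rewrite separable_prod_XsubC.
  rewrite unlock => /Pdiv.ClosedField.coprimepP; apply.
  by rewrite root_prod_XsubC.
have DgU x : g^`().[x] = U^`().[f1.[x]] * f1^`().[x].
  by rewrite -DU deriv_comp hornerM horner_comp.
have DgV x : g^`().[x] = V^`().[f2.[x]] * f2^`().[x].
  by rewrite -DV deriv_comp hornerM horner_comp.
have Ua : U^`().[f1.[a]] != 0 by move: g'a; rewrite DgU mulf_eq0 => /norP[].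
have Va : V^`().[f2.[a]] != 0 by move: g'a; rewrite DgV mulf_eq0 => /norP[].
have Da := DgU a; rewrite DgV in Da.
have Db := DgU b; rewrite DgV -e1 -e2 in Db.
apply: (mulfI (mulf_neq0 Ua Va)); rewrite mulrACA [RHS]mulrACA.
by rewrite Da Db mulrC.
Qed.

(** * Degrees of algebraic elements *)

(** Minimal polynomials up to a scalar: only their sizes matter, so no
    normalization is imposed. *)
Definition minimal_polynomial (K L : fieldType) (iota : {rmorphism K -> L})
    (z : L) (p : {poly K}) : Prop :=
  root (map_poly iota p) z /\ irreducible_poly p.

Section Degree.
Variables (K L : fieldType) (iota : {rmorphism K -> L}).
Local Notation minpoly := (minimal_polynomial iota).

Lemma minimal_polynomial_exists z :
  algebraicOver iota z -> exists p, minpoly z p.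
Proof.
case=> p0; have [n] := ubnP (size p0); elim: n p0 => // n IHn p0 le_p0n nz0 p0z.
pose is_min := forall q : {poly K},
  root (map_poly iota q) z -> q != 0 -> (size p0 <= size q)%N.
have [min_p0 | not_min] := classic is_min.
  by exists p0; split=> //; apply/(subfx_irreducibleP p0z nz0).
have [q q_smaller] := not_all_ex_not _ _ not_min.
have [qz q_nz_smaller] := imply_to_and _ _ q_smaller.
have [nzq /negP] := imply_to_and _ _ q_nz_smaller.
rewrite -ltnNge => lt_q_p0.
exact: IHn q (leq_trans lt_q_p0 le_p0n) nzq qz.
Qed.

Lemma minimal_polynomial_leq z p q :
  minpoly z p -> root (map_poly iota q) z -> q != 0 -> (size p <= size q)%N.
Proof.
case=> pz irr_p; have [p_gt1 _] := irr_p.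
have nzp : p != 0 by rewrite -size_poly_gt0 ltnW.
exact: (proj2 (subfx_irreducibleP pz nzp)).
Qed.

(** That is, [[K(r(z)) : K]] divides [[K(z) : K]].  The field [K(z)] is realized
    as an abstract finite extension [E] of [K], of degree [(size p).-1]; the
    element [r(z)] generates a subfield of [E], whose dimension divides that of
    [E] by the tower law. *)
Lemma minimal_polynomial_dvd z p r s :
  minpoly z p -> minpoly (map_poly iota r).[z] s ->
  ((size s).-1 %| (size p).-1)%N.
Proof.
move=> min_p min_s; have [pz irr_p] := min_p; have [p_gt1 _] := irr_p.
have nzp : p != 0 by rewrite -size_poly_gt0 ltnW.
pose E := SubFieldExtType pz irr_p.
have dimE : \dim {: E} = (size p).-1 by rewrite dimvf.
pose j : {rmorphism E -> L} := @subfx_inj _ _ iota z p.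
pose w : E := subfx_eval iota z p r.
have jw : j w = (map_poly iota r).[z] by exact: subfx_inj_eval.
have j_base (q : {poly K}) :
    map_poly j (map_poly (in_alg E) q) = map_poly iota q.
  rewrite -map_poly_comp; apply: eq_map_poly => c; exact: subfx_inj_base.
have rootE q : root (map_poly iota q) (j w) = root (map_poly (in_alg E) q) w.
  by rewrite -j_base fmorph_root.
have /polyOver1P[q Dq] := minPolyOver 1 w.
have nzq : q != 0.
  by rewrite -(map_poly_eq0 (in_alg E)) -Dq monic_neq0 ?monic_minPoly.
(* [s] and the polynomial [q] found inside [E] are both minimal for [j w]. *)
have size_s : size s = size q.
  apply/eqP; rewrite eqn_leq (minimal_polynomial_leq min_s) //=; last first.
    by rewrite -jw rootE -Dq root_minPoly.
  have [sw [s_gt1 _]] := min_s.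
  rewrite -(size_map_poly (in_alg E) q) -Dq -(size_map_poly (in_alg E) s).
  rewrite dvdp_leq ?map_poly_eq0 -?size_poly_gt0 1?ltnW //.
  by rewrite minPoly_dvdp ?alg_polyOver // -rootE jw.
rewrite size_s -(size_map_poly (in_alg E) q) -Dq size_minPoly /= -dimE.
have <- : \dim <<1; w>> = adjoin_degree 1 w by rewrite dim_Fadjoin dimv1 muln1.
exact/field_dimS/subvf.
Qed.

Lemma in_adjoin_horner z (q : {poly K}) :
  in_adjoin iota z (map_poly iota q).[z].
Proof.
have in0 : in_adjoin iota z 0.
  by rewrite -(rmorph0 iota); exact: in_adjoin_base.
have in1 : in_adjoin iota z 1.
  by rewrite -(rmorph1 iota); exact: in_adjoin_base.
(* Sums and products come from the two constructors for [-] and [/]. *)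
have inD x y : in_adjoin iota z x -> in_adjoin iota z y ->
    in_adjoin iota z (x + y).
  move=> inx iny; rewrite -[y]opprK; apply: in_adjoin_sub => //.
  by rewrite -sub0r; exact: in_adjoin_sub.
have inM x y : in_adjoin iota z x -> in_adjoin iota z y ->
    in_adjoin iota z (x * y).
  move=> inx iny; rewrite -[y]invrK; apply: in_adjoin_div => //.
  by rewrite -[y^-1]mul1r; exact: in_adjoin_div.
elim/poly_ind: q => [|q c IHq]; first by rewrite rmorph0 horner0.
rewrite rmorphD rmorphM /= map_polyX map_polyC /= !hornerE.
by apply: inD; [apply: inM => //; exact: in_adjoin_gen | exact: in_adjoin_base].
Qed.

(** The elements of [K(z)] in the inductive sense are the images of the abstract
    extension [E] of [K] defined by [p], and a basis of [K(z)] pulls back to a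
    basis of [E]. *)
Lemma adjoin_has_degreeE z d p :
  adjoin_has_degree iota z d -> minpoly z p -> d = (size p).-1.
Proof.
case=> b [b_in b_span b_free] [pz irr_p]; have [p_gt1 _] := irr_p.
have nzp : p != 0 by rewrite -size_poly_gt0 ltnW.
pose E := SubFieldExtType pz irr_p.
have dimE : \dim {: E} = (size p).-1 by rewrite dimvf.
pose j : {rmorphism E -> L} := @subfx_inj _ _ iota z p.
have jZ c (x : E) : j (c *: x) = iota c * j x by exact: subfx_injZ.
have jP x : in_adjoin iota z x -> exists e : E, j e = x.
  elim=> [c||x1 y1 _ [e1 <-] _ [e2 <-]|x1 y1 _ [e1 <-] _ [e2 <-]].
  - by exists (c%:A); rewrite jZ rmorph1 mulr1.
  - by exists (subfx_root iota z p); exact: subfx_inj_root.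
  - by exists (e1 - e2); rewrite rmorphB.
  - by exists (e1 / e2); rewrite fmorph_div.
have Pj e : in_adjoin iota z (j e).
  have [q ->] := subfxE e; rewrite /j /= subfx_inj_eval //.
  exact: in_adjoin_horner.
have [e je] : exists e : {ffun 'I_d -> E}, forall i, j (e i) = b i.
  have /fin_all_exists[e je] : forall i, exists x : E, j x = b i.
    by move=> i; exact: jP.
  by exists (finfun e) => i; rewrite ffunE.
pose X := [tuple e i | i < d].
have sumX (k : 'I_d -> K) :
    j (\sum_(i < d) k i *: X`_i) = \sum_(i < d) iota (k i) * b i.
  by rewrite rmorph_sum; apply: eq_bigr => i _; rewrite jZ nth_mktuple -je.
have freeX : free X.
  by apply/freeP => k k0; apply: b_free; rewrite -sumX k0 rmorph0.
have spanX : <<X>>%VS = fullv.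
  apply/vspaceP => x; rewrite memvf.
  have [c Dx] := b_span _ (Pj x).
  have -> : x = \sum_(i < d) c i *: X`_i by apply: (fmorph_inj j); rewrite sumX.
  rewrite memv_suml // => i _; rewrite memvZ // memv_span // mem_nth //.
  by rewrite size_tuple.
by rewrite -dimE -spanX (eqnP freeX) size_tuple.
Qed.

Definition divides_degree (q : nat) (z : L) : Prop :=
  exists2 p, minpoly z p & (q %| (size p).-1)%N.

(** Let [s], of degree [n], be the minimal polynomial of [f(x) = f(y)].  The
    degree of [x] is a multiple [k * n] of [n], and it is at most [n * deg f]
    because [s \Po f] vanishes at [x].  So [0 < k <= deg f < q], and the prime
    [q] divides [n], which divides the degree of [y]. *)
Lemma divides_degree_fibre (q : nat) (f : {poly K}) (x y : L) :
  (forall z, algebraicOver iota z) -> prime q ->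
  (1 < size f)%N -> ((size f).-1 < q)%N ->
  (map_poly iota f).[x] = (map_poly iota f).[y] ->
  divides_degree q x -> divides_degree q y.
Proof.
move=> alg q_pr f_nonconst f_small eq_xy [p min_p q_dvd].
have [s min_s] := minimal_polynomial_exists (alg (map_poly iota f).[x]).
have [t min_t] := minimal_polynomial_exists (alg y).
exists t => //.
suff q_dvd_s : (q %| (size s).-1)%N.
  rewrite eq_xy in min_s.
  exact: dvdn_trans q_dvd_s (minimal_polynomial_dvd min_t min_s).
have [k Dk] := dvdnP (minimal_polynomial_dvd min_p min_s).
have [sx [s_gt1 _]] := min_s.
have nzs : s != 0 by rewrite -size_poly_gt0 ltnW.
have [_ [p_gt1 _]] := min_p.
have : ((size p).-1 <= (size f).-1 * (size s).-1)%N.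
  rewrite mulnC -size_comp_poly -!subn1 leq_sub2r //.
  apply: (minimal_polynomial_leq min_p); last by rewrite comp_poly_eq0.
  by rewrite map_comp_poly root_comp.
have s1_gt0 : (0 < (size s).-1)%N by rewrite -subn1 subn_gt0.
rewrite Dk leq_pmul2r // => le_kf.
have k_gt0 : (0 < k)%N.
  rewrite lt0n; apply: contraTneq p_gt1 => k0.
  by rewrite -leqNgt -subn_eq0 subn1 Dk k0.
move: q_dvd; rewrite Dk Euclid_dvdM // => /orP[/dvdn_leq|//].
by move=> /(_ k_gt0); rewrite leqNgt (leq_ltn_trans le_kf f_small).
Qed.

Lemma divides_degree_neq0 (q : nat) (f : {poly K}) (x : L) :
  f != 0 -> ((size f).-1 < q)%N ->
  divides_degree q x -> (map_poly iota f).[x] != 0.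
Proof.
move=> nzf f_small [p min_p q_dvd]; apply/negP => fx.
have le_pf := minimal_polynomial_leq min_p fx nzf.
have [_ [p_gt1 _]] := min_p.
have p1_gt0 : (0 < (size p).-1)%N by rewrite -subn1 subn_gt0.
have := leq_trans f_small (dvdn_leq p1_gt0 q_dvd).
by rewrite -!subn1 ltnNge leq_sub2r.
Qed.

End Degree.

(** Filtering by an undecided property; excluded middle settles each of the
    finitely many cases. *)
Lemma seq_sieve (T : eqType) (P : T -> Prop) (s : seq T) :
  exists2 t : seq T, uniq t & forall x, x \in t <-> x \in s /\ P x.
Proof.
elim: s => [|a s [t t_uniq tP]].
  by exists [::] => // x; split=> [|[]].
have [Pa | nPa] := classic (P a).
  exists (undup (a :: t)); first exact: undup_uniq.
  move=> x; rewrite mem_undup !inE; case: eqVneq => [->|_] /=; first by split.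
  exact: tP.
exists t => // x; rewrite inE tP; case: eqVneq => [->|_] /=; last by [].
by split=> [[]|[]].
Qed.

(** * Polynomials without a common composite *)

Theorem theorem1p2 (K : fieldType) (L : closedFieldType)
  (iota : {rmorphism K -> L}) (hL : algebraic_closure iota)
  (f1 f2 : {poly K}) (hf1 : f1^`() != 0) (hf2 : f2^`() != 0)
  (alpha beta : L)
  (h1 : (map_poly iota f1).[alpha] = (map_poly iota f1).[beta])
  (h2 : (map_poly iota f2).[alpha] = (map_poly iota f2).[beta])
  (hcond :
    let m1 := fval_mult (map_poly iota f1) in
    let m2 := fval_mult (map_poly iota f2) in
    let df1 := map_poly iota f1^`() in
    let df2 := map_poly iota f2^`() in
    (m1 alpha * m2 beta)%N <> (m1 beta * m2 alpha)%N
    \/ (df1.[alpha] * df2.[beta] <> df1.[beta] * df2.[alpha]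
        /\ exists d q : nat,
             [/\ adjoin_has_degree iota alpha d, prime q, (q %| d)%N
               & (maxn (size f1).-1 (size f2).-1 < q)%N])) :
  ~ common_composite f1 f2.
Proof.
have nonconst (f : {poly K}) : f^`() != 0 -> (1 < size f)%N.
  by rewrite ltnNge; apply: contra_neqN => /size1_polyC->; rewrite derivC.
have nc1 := nonconst _ hf1; have nc2 := nonconst _ hf2.
case=> u [v [ncu ncv Duv]].
pose F1 := map_poly iota f1; pose F2 := map_poly iota f2.
pose U := map_poly iota u; pose V := map_poly iota v.
have DUV : U \Po F1 = V \Po F2 by rewrite -!map_comp_poly Duv.
case: hcond => [[] | [neq_df [d [q [adj_d q_pr q_dvd]]]]].
  by apply: (@fval_mult_common _ _ _ U V); rewrite ?size_map_poly.
rewrite gtn_max => /andP[f1_small f2_small]; apply: neq_df.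
have DH x : (U \Po F1).[x] = U.[F1.[x]] by exact: horner_comp.
(* The sieve only needs [H] to have finitely many roots, that is, [H != 0]. *)
pose H := U \Po F1 - (U \Po F1).[alpha]%:P.
have nzH : H != 0.
  rewrite subr_eq0; apply: contraTneq ncu => UF1_const.
  have := congr1 (fun p : {poly L} => (size p).-1) UF1_const.
  rewrite size_comp_poly !size_map_poly size_polyC.
  have : (0 < (size f1).-1)%N by rewrite -subn1 subn_gt0.
  by case: (_ != 0); case: (size u) => [|[|n]] //; case: (_.-1).
have [roots_H DrH] := closed_field_poly_normal H.
have roots_HP x : (x \in roots_H) = ((U \Po F1).[x] == (U \Po F1).[alpha]).
  have nzlH : lead_coef H != 0 by rewrite lead_coef_eq0.
  rewrite -root_prod_XsubC -(rootZ _ _ nzlH) -DrH.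
  by rewrite rootE hornerD hornerN hornerC subr_eq0.
have [C uniqC CP] := seq_sieve (divides_degree iota q) roots_H.
have q_alpha : divides_degree iota q alpha.
  have [p min_p] := minimal_polynomial_exists (hL alpha).
  by exists p; rewrite -?(adjoin_has_degreeE adj_d min_p).
have f'C (f : {poly K}) : f^`() != 0 -> ((size f).-1 < q)%N ->
    {in C, forall c, (map_poly iota f)^`().[c] != 0}.
  move=> nzf' f_small c /CP[_ q_c]; rewrite deriv_map.
  apply: (divides_degree_neq0 nzf' _ q_c).
  apply: leq_ltn_trans f_small.
  rewrite -!subn1 leq_sub2r // ltnW // lt_size_deriv //.
  by rewrite -size_poly_gt0 ltnW ?nonconst.
have closedC (f : {poly K}) : (1 < size f)%N -> ((size f).-1 < q)%N ->
    (forall x y, (map_poly iota f).[x] = (map_poly iota f).[y] ->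
       (U \Po F1).[x] = (U \Po F1).[y]) ->
    forall c e, c \in C -> (map_poly iota f).[c] = (map_poly iota f).[e] ->
      e \in C.
  move=> nc f_small fibre c e /CP[Hc q_c] f_ce; apply/CP; split.
    by rewrite roots_HP -(fibre _ _ f_ce) -roots_HP.
  exact: (divides_degree_fibre hL q_pr nc f_small f_ce q_c).
rewrite -!deriv_map.
apply: (@deriv_common_fibres _ F1 F2 C); rewrite ?size_map_poly //.
- exact: f'C.
- exact: f'C.
- by apply: closedC => // x y e; rewrite !DH e.
- by apply: closedC => // x y e; rewrite DUV !horner_comp e.
- by apply/CP; rewrite roots_HP.
Qed.
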